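(* Let $L\ge2$ and let $p,q\ge0$ be real. For any pair of sectors $\mathfrak{s}\subset\mathfrak{t}\subseteq\Omega=\{1,\dots,L-1\}$ there is an embedding of multisets $\mathrm{Spec}(\mathfrak{s})\hookrightarrow\mathrm{Spec}(\mathfrak{t})$, i.e. every eigenvalue of $H_{\mathfrak{s}}$ occurs in $\mathrm{Spec}(\mathfrak{t})$ with at least its multiplicity in $\mathrm{Spec}(\mathfrak{s})$. In particular, $\mathrm{Spec}(\Omega)$ contains the eigenvalues of the Hamiltonian $H_{\mathfrak{s}}$ of all the sectors $\mathfrak{s}\subseteq\Omega$.
   Context: Sectors. Fix $L\ge 2$ and $\Omega=\{1,\dots,L-1\}$. A sector is a subset $\mathfrak{s}=\{s_1<\dots<s_{n-1}\}$ of $\Omega$; write $s_0=0$, $s_n=L$. $\mathcal{P}(\mathfrak{s})$ is the set of all sequences $k=(k_1,\dots,k_L)$ in which each value $i\in\{1,\dots,n\}$ occurs exactly $s_i-s_{i-1}$ times (so $\mathcal{P}(\emptyset)=\{(1,\dots,1)\}$). $V_{\mathfrak{s}}$ is the complex vector space with basis $|k\rangle$, $k\in\mathcal{P}(\mathfrak{s})$. Hamiltonian. For real $p,q\ge0$ let $\Theta(x)=p$ for $x>0$, $0$ for $x=0$, $q$ for $x<0$. $H_{\mathfrak{s}}:V_{\mathfrak{s}}\to V_{\mathfrak{s}}$ is the linear map $H_{\mathfrak{s}}|k\rangle=\sum_{i\in\mathbb{Z}/L\mathbb{Z}}\Theta(k_i-k_{i+1})\bigl(|k^{(i)}\rangle-|k\rangle\bigr)$,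 where indices are taken mod $L$ and $k^{(i)}$ is $k$ with $k_i$ and $k_{i+1}$ interchanged. (This is the Markov matrix of the multi-species asymmetric simple exclusion process on a ring of $L$ sites.) $\mathrm{Spec}(\mathfrak{s})$ is the multiset of eigenvalues of $H_{\mathfrak{s}}$ counted with algebraic multiplicity, so that $\sharp\mathrm{Spec}(\mathfrak{s})=\dim V_{\mathfrak{s}}$. *)

(* Defs.v *)
From mathcomp Require Import all_boot all_order all_algebra perm.
From mathcomp Require Import finmap multiset complex reals.

Set Implicit Arguments.
Unset Strict Implicit.
Unset Printing Implicit Defensive.

Import Order.TTheory GRing.Theory Num.Theory.
Local Open Scope ring_scope.
Local Open Scope complex_scope.

(* A subset of {1, .., L-1} is a set in 'I_L = {0, .., L-1} avoiding 0. *)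
Definition Omega (L : nat) : {set 'I_L} := [set i : 'I_L | (0 < i)%N].

Section Sector.

Variables (L : nat) (s : {set 'I_L}).

(* The list s_0 = 0, s_1 < ... < s_(n-1), s_n = L (enum s is increasing),
   where n = #|s|.+1. *)
Definition sector_pts : seq nat := 0%N :: rcons [seq val i | i <- enum s] L.

(* The n values are numbered from 0: v : 'I_n stands for the value v + 1.
   The dynamics only depends on their order. *)
Definition config := {ffun 'I_L -> 'I_(#|s|.+1)}.

Definition configs : {set config} :=
  [set k : config | [forall v : 'I_(#|s|.+1),
     #|[set i | k i == v]|
       == (nth 0 sector_pts v.+1 - nth 0 sector_pts v)%N]].

(* ordS is the cyclic successor on 'I_L. *)
Definition swap (i : 'I_L) (k : config) : config :=
  [ffun j => k (tperm i (ordS i) j)].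

Lemma swap_configs i k : k \in configs -> swap i k \in configs.
Proof.
rewrite !inE => /forallP kP; apply/forallP=> v; rewrite -(eqP (kP v)).
rewrite -(card_imset [set j | swap i k j == v] (@perm_inj _ (tperm i (ordS i)))).
apply/eqP/eq_card => j; rewrite inE; apply/imsetP/idP => [[j' + ->]|kj].
  by rewrite inE ffunE.
by exists (tperm i (ordS i) j); rewrite ?tpermK // inE ffunE tpermK.
Qed.

End Sector.

Definition Theta (R : realType) (p q : R) (x : int) : R :=
  if 0 < x then p else if x < 0 then q else 0.

Section Hamiltonian.

Variables (R : realType) (p q : R) (L : nat) (s : {set 'I_L}).

(* V_s is identified with the column vectors indexed by configs s. *)
Definition ket (k : config s) : 'cV[R[i]]_#|configs s| :=
  \col_a (enum_val a == k)%:R.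

Definition H_ket (k : config s) : 'cV[R[i]]_#|configs s| :=
  \sum_(i < L) (Theta p q ((k i)%:Z - (k (ordS i))%:Z))%:C
                 *: (ket (swap i k) - ket k).

Definition Hamiltonian : 'M[R[i]]_#|configs s| :=
  \matrix_(a, b) H_ket (enum_val b) a 0.

Lemma Hamiltonian_ket k : k \in configs s -> Hamiltonian *m ket k = H_ket k.
Proof.
move=> kP; apply/colP=> a; rewrite !mxE (bigD1 (enum_rank_in kP k)) //=.
rewrite !mxE enum_rankK_in // eqxx mulr1 big1 ?addr0 // => b nb.
rewrite !mxE; case: eqP => [eb|]; last by rewrite mulr0.
by case/eqP: nb; apply: enum_val_inj; rewrite eb enum_rankK_in.
Qed.

(* Eigenvalues with algebraic multiplicity: the roots of the (split)
   characteristic polynomial. *)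
Definition Spec : {mset R[i]}%mset :=
  seq_mset (sval (closed_field_poly_normal (char_poly Hamiltonian))).

Lemma SpecE x : Spec x = mup x (char_poly Hamiltonian).
Proof.
rewrite mset_seqE; case: closed_field_poly_normal => r /= ->.
by rewrite (monicP (char_poly_monic _)) scale1r mu_prod_XsubC.
Qed.

Lemma size_Spec : size Spec = #|configs s|.
Proof.
rewrite (perm_size (perm_eq_seq_mset _)).
have := size_char_poly Hamiltonian; case: closed_field_poly_normal => r /= ->.
rewrite (monicP (char_poly_monic _)) scale1r size_prod_XsubC.
by case.
Qed.

End Hamiltonian.

(* Main.v *)
(* Let t refine s. Merging the species of the sector t that s does not
   distinguish defines a linear surjection P : V_t -> V_s. Merging is weakly
   monotone on species, and exchanging two merged species does nothing in V_s,
   so P intertwines the two Hamiltonians: P H_t = H_s P. Hence H_s is a quotient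
   of H_t, and its characteristic polynomial divides that of H_t. *)
Require Import Defs.
From mathcomp Require Import all_boot all_order all_algebra.
From mathcomp Require Import perm.
From mathcomp Require Import finmap multiset complex reals.

Set Implicit Arguments.
Unset Strict Implicit.
Unset Printing Implicit Defensive.

Import Order.TTheory GRing.Theory Num.Theory.
Local Open Scope ring_scope.

(** * Characteristic polynomials under intertwining *)

Lemma char_poly_mx_intertwine (R : comNzRingType) m n (P : 'M[R]_(m, n))
    (A : 'M[R]_n) (B : 'M[R]_m) : P *m A = B *m P ->
  map_mx polyC P *m char_poly_mx A = char_poly_mx B *m map_mx polyC P.
Proof.
move=> PA; rewrite /char_poly_mx mulmxBr mulmxBl -!map_mxM PA.
by rewrite scalar_mxC.
Qed.

(** Take determinants in the relation between the characteristic matrices: [\det U] is a nonzero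
    constant and cancels. *)
Lemma char_poly_conj (F : fieldType) n (U A B : 'M[F]_n) :
  U \in unitmx -> U *m A = B *m U -> char_poly A = char_poly B.
Proof.
move=> Uu /char_poly_mx_intertwine /(congr1 determinant).
rewrite !det_mulmx mulrC; apply: mulIf.
by rewrite det_map_mx polyC_eq0 -unitfE -unitmxE.
Qed.

Lemma char_poly_lblock (R : comNzRingType) m n (A : 'M[R]_m) (C : 'M[R]_(n, m))
    (D : 'M[R]_n) :
  char_poly (block_mx A 0 C D) = char_poly A * char_poly D.
Proof.
rewrite /char_poly /char_poly_mx map_block_mx map_mx0 scalar_mx_block.
by rewrite opp_block_mx add_block_mx oppr0 addr0 det_lblock.
Qed.

(** Completing the rows of [P] to a basis makes [A] block lower triangular, with [B] as its upper
    left block. *)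
Lemma dvdp_char_poly_quotient (F : fieldType) m n (P : 'M[F]_(m, n))
    (A : 'M[F]_n) (B : 'M[F]_m) :
  row_free P -> P *m A = B *m P -> char_poly B %| char_poly A.
Proof.
move=> Pfree; have le_mn : (m <= n)%N by rewrite -(eqP Pfree) rank_leq_col.
rewrite -(subnKC le_mn) in P A Pfree *; move: (n - m)%N P A Pfree => r P A Pfree PA.
(* [P] has full row rank, so its decomposition by [mulmx_ebase] says that the first [m] rows of this
   invertible matrix form [P]. *)
pose U := block_mx (col_ebase P) 0 0 1%:M *m row_ebase P.
have Uu : U \in unitmx.
  by rewrite unitmx_mul row_ebase_unit andbT unitmxE det_lblock det1 mulr1
    -unitmxE col_ebase_unit.
have defP : P = row_mx 1%:M 0 *m U.
  rewrite mulmxA mul_row_block !mul1mx !mul0mx !addr0 -{1}(mulmx_ebase P).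
  congr (_ *m _); rewrite (eqP Pfree) pid_mx_row.
  by rewrite mul_mx_row mulmx1 mulmx0.
move: U Uu defP => U Uu defP.
pose A' := U *m A *m invmx U.
have UA : U *m A = A' *m U by rewrite mulmxKV.
have eA' : row_mx 1%:M 0 *m A' = row_mx B 0.
  rewrite /A' !mulmxA -defP PA defP !mulmxA mulmxK //.
  by rewrite mul_mx_row mulmx1 mulmx0.
rewrite (char_poly_conj Uu UA) -[A']submxK.
move: eA'; rewrite -[A' in LHS]submxK mul_row_block !mul1mx !mul0mx !addr0.
by case/eq_row_mx=> -> ->; rewrite char_poly_lblock dvdp_mulr.
Qed.

(** * Configurations as rearrangements of a standard one *)

(** In an increasing list the entries at most [x] form an initial segment. *)
Lemma ltn_count_sorted (e : seq nat) (x v : nat) : sorted ltn e ->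
  (v < count (leq^~ x) e)%N = (v < size e)%N && (nth 0%N e v <= x)%N.
Proof.
elim: e v => [|a e IHe] v //= ae; have se := path_sorted ae.
have /allP lt_ae := order_path_min ltn_trans ae.
case: (leqP a x) => [ax|xa]; first by case: v => [|v] //=; rewrite add1n !ltnS IHe.
rewrite add0n [count _ _](_ : _ = 0%N); last first.
  apply/eqP; rewrite -leqn0 leqNgt -has_count; apply/hasPn => y /lt_ae ay.
  by rewrite -ltnNge (ltn_trans xa).
case: v => [|v] /=; first by rewrite [RHS]leqNgt xa.
apply/esym/negbTE/negP => /andP[ve]; apply/negP; rewrite -ltnNge.
exact: ltn_trans xa (lt_ae _ (mem_nth 0%N ve)).
Qed.

Lemma card_ord_geq (L a : nat) : #|[set x : 'I_L | (a <= x)%N]| = (L - a)%N.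
Proof.
rewrite cardsE cardE size_filter -enumT -(count_map val (leq a)) val_enum_ord.
elim: L => [|L IHL] //; rewrite -[in LHS]addn1 iotaD count_cat IHL /= addn0.
case: leqP => [aL|La]; first by rewrite addn1 subSn.
by move: (La) (ltnW La); rewrite -!subn_eq0 => /eqP-> /eqP->.
Qed.

Section StandardConfig.

Variables (L : nat) (s : {set 'I_L}).

(** Read as a sequence over the sites, this is the weakly increasing configuration of the sector;
    sites count from 0, so each point of [s] opens a new block. *)
Definition block_of (x : 'I_L) : 'I_(#|s|.+1) :=
  inord #|[set y in s | (y <= x)%N]|.

Lemma block_ofE x : block_of x = #|[set y in s | (y <= x)%N]| :> nat.
Proof.
rewrite inordK // ltnS; apply: subset_leq_card.
by apply/subsetP => y; rewrite inE => /andP[].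
Qed.

Lemma block_of_homo (x y : 'I_L) : (x <= y)%N -> (block_of x <= block_of y)%N.
Proof.
move=> xy; rewrite !block_ofE; apply: subset_leq_card.
by apply/subsetP => z; rewrite !inE => /andP[-> /leq_trans->].
Qed.

Lemma leq_block_of v (x : 'I_L) : (v <= #|s|.+1)%N ->
  (v <= block_of x)%N = (nth 0%N (sector_pts s) v <= x)%N.
Proof.
case: v => [|v] //=; rewrite ltnS => vs.
have -> : block_of x = count (leq^~ x) [seq val i | i <- enum s] :> nat.
  rewrite block_ofE count_map -size_filter cardE; apply: perm_size.
  apply: uniq_perm => [||y]; first exact: enum_uniq.
    exact/filter_uniq/enum_uniq.
  by rewrite [RHS]mem_filter !mem_enum inE andbC.
rewrite ltn_count_sorted; last first.
  rewrite sorted_map; apply: sorted_filter; first by move=> ? ? ?; apply: ltn_trans.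
  by rewrite -enumT -(@sorted_map _ _ val ltn) val_enum_ord iota_ltn_sorted.
(* The case left is [v = #|s|]: the final point [L] lies beyond every site. *)
rewrite nth_rcons size_map -cardE; case: ltngtP vs => //= _ _.
by apply/esym/negbTE; rewrite -ltnNge.
Qed.

(** Block [v] is an interval of sites, the difference of two final segments. *)
Lemma card_block v : #|[set x | block_of x == v]|
  = (nth 0%N (sector_pts s) v.+1 - nth 0%N (sector_pts s) v)%N.
Proof.
set a := nth _ _ _; set b := nth _ _ _.
have -> : [set x | block_of x == v]
    = [set x : 'I_L | (b <= x)%N] :\: [set x : 'I_L | (a <= x)%N].
  apply/setP=> x; rewrite !inE /a /b -(leq_block_of _ (ltn_ord v)).
  rewrite -leq_block_of ?(ltnW (ltn_ord v)) //.
  by rewrite -leqNgt -eqn_leq.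
rewrite cardsDS ?card_ord_geq; last first.
  apply/subsetP => x; rewrite !inE /a /b -(leq_block_of _ (ltn_ord v)).
  by rewrite -leq_block_of ?(ltnW (ltn_ord v)) //; apply: ltnW.
rewrite subnAC subKn //.
have : all (leq^~ L) (sector_pts s).
  rewrite /= all_rcons leqnn; apply/allP => _ /mapP[i _ ->].
  exact/ltnW/ltn_ord.
by move/all_nthP; apply; rewrite /= size_rcons size_map -cardE ltnS.
Qed.

(** Equal species counts mean equality up to a permutation of sites. As [u] does not refer to the
    sector, it carries configurations from one sector to another. *)
Lemma configsP (k : config s) :
  reflect (exists u : 'S_L, k = [ffun i => block_of (u i)]) (k \in configs s).
Proof.
apply: (iffP idP) => [|[u ->]]; rewrite inE; last first.
  apply/forallP => v; rewrite -card_block; apply/eqP.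
  rewrite -(card_imset [set i | _ i == v] (@perm_inj _ u)).
  apply: eq_card => j; apply/imsetP/idP => [[i + ->]|]; rewrite !inE ?ffunE //.
  by move=> jv; exists (u^-1 j)%g; rewrite ?inE ?ffunE permKV.
move=> /forallP kP.
have : perm_eq [tuple k i | i < L] [tuple block_of i | i < L].
  apply/allP => v _ /=; apply/eqP.
  have cE (f : 'I_L -> 'I_(#|s|.+1)) :
      count_mem v [tuple f i | i < L] = #|[set i | f i == v]|.
    rewrite count_map cardsE [RHS]cardE val_ord_tuple enumT size_filter.
    exact: eq_count.
  by rewrite !cE card_block (eqP (kP v)).
case/tuple_permP=> u e; exists u; apply/ffunP => i.
move/val_inj: e => /(congr1 (fun w => tnth w i)).
by rewrite !tnth_mktuple ffunE.
Qed.

End StandardConfig.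

(** * Merging species *)

Section Merge.

Variables (L : nat) (s t : {set 'I_L}).
Hypothesis st : s \subset t.

Lemma block_of_refine x y : (block_of t x <= block_of t y)%N ->
  (block_of s x <= block_of s y)%N.
Proof.
case: (leqP x y) => [xy _|yx]; first exact: block_of_homo.
rewrite !block_ofE => txy.
(* Nested sets with the cardinalities ordered the other way coincide: no point of [t], hence none of
   [s], separates [y] from [x]. *)
have sub : [set z in t | (z <= y)%N] \subset [set z in t | (z <= x)%N].
  apply/subsetP => z; rewrite !inE => /andP[-> zy].
  exact: leq_trans zy (ltnW yx).
have /eqP e : [set z in t | (z <= y)%N] == [set z in t | (z <= x)%N].
  by rewrite eqEcard sub.
apply: subset_leq_card; apply/subsetP => z; rewrite !inE => /andP[zs zx].
move/setP/(_ z): e; rewrite !inE (subsetP st _ zs) zx zs /=.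
by move=> ->.
Qed.

Lemma block_of_refine_eq x y :
  block_of t x = block_of t y -> block_of s x = block_of s y.
Proof.
by move=> e; apply/val_inj/eqP; rewrite eqn_leq !block_of_refine ?e.
Qed.

(* Species that do not occur in the sector are sent to a junk value. *)
Definition merge_species (v : 'I_(#|t|.+1)) : 'I_(#|s|.+1) :=
  odflt ord0 (omap (block_of s) [pick x | block_of t x == v]).

Lemma merge_species_block x : merge_species (block_of t x) = block_of s x.
Proof.
rewrite /merge_species; case: pickP => [y /eqP/block_of_refine_eq //|/(_ x)].
by rewrite eqxx.
Qed.

Definition merge (k : config t) : config s := [ffun i => merge_species (k i)].

Lemma merge_perm (u : 'S_L) :
  merge [ffun i => block_of t (u i)] = [ffun i => block_of s (u i)].
Proof. by apply/ffunP => i; rewrite !ffunE merge_species_block. Qed.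

Lemma merge_configs k : k \in configs t -> merge k \in configs s.
Proof. by case/configsP => u ->; apply/configsP; exists u; rewrite merge_perm. Qed.

(** The permutation giving [k] from the standard configuration of [s] gives a preimage from that of
    [t]. *)
Lemma merge_onto k : k \in configs s -> exists2 k', k' \in configs t & merge k' = k.
Proof.
case/configsP => u ->; exists [ffun i => block_of t (u i)]; last exact: merge_perm.
by apply/configsP; exists u.
Qed.

Lemma merge_swap i k : merge (swap i k) = swap i (merge k).
Proof. by apply/ffunP => j; rewrite !ffunE. Qed.

(** Membership of [k] ensures that both species occur, so no junk value interferes. *)
Lemma merge_species_le k i j : k \in configs t ->
  (k i <= k j)%N -> (merge k i <= merge k j)%N.
Proof.
case/configsP => u ->; rewrite !ffunE !merge_species_block.
exact: block_of_refine.
Qed.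

Lemma swap_id (k : config s) i : k i = k (ordS i) -> swap i k = k.
Proof. by move=> e; apply/ffunP => j; rewrite ffunE; case: tpermP => [->|->|]. Qed.

(** * The intertwining of the Hamiltonians *)

Variables (R : realType) (p q : R).

(** [Theta] sees only the sign of a difference, and a weakly monotone map keeps the sign of every
    difference that it does not send to 0. *)
Lemma Theta_merge k i : k \in configs t -> merge k i != merge k (ordS i) ->
  Theta p q ((k i)%:Z - (k (ordS i))%:Z)
    = Theta p q ((merge k i)%:Z - (merge k (ordS i))%:Z).
Proof.
move=> kP; rewrite /Theta !subr_gt0 !subr_lt0 !ltz_nat -val_eqE /=.
have := @merge_species_le k i (ordS i) kP; have := @merge_species_le k (ordS i) i kP.
case: (ltngtP (k i)) => _; case: ltngtP => // _ h1 h2 _.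
all: by [have := h1 isT | have := h2 isT].
Qed.

Definition merge_mx : 'M[R[i]]_(#|configs s|, #|configs t|) :=
  \matrix_(a, b) (enum_val a == merge (enum_val b))%:R.

Lemma ket_enum_val (b : 'I_#|configs t|) : ket R (enum_val b) = delta_mx b 0.
Proof. by apply/colP => a; rewrite !mxE (inj_eq enum_val_inj) andbT. Qed.

Lemma merge_mx_ket k : k \in configs t -> merge_mx *m ket R k = ket R (merge k).
Proof.
move=> kP; rewrite -[k in LHS](enum_rankK_in kP kP) ket_enum_val -colE.
by apply/colP => a; rewrite !mxE enum_rankK_in.
Qed.

Lemma merge_mx_Hamiltonian :
  merge_mx *m Hamiltonian p q t = Hamiltonian p q s *m merge_mx.
Proof.
apply/row_matrixP => a; apply/rowP => b.
have kP := enum_valP b; set k := enum_val b in kP.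
suff /colP/(_ a) : merge_mx *m Hamiltonian p q t *m ket R k
     = Hamiltonian p q s *m merge_mx *m ket R k.
  by rewrite ket_enum_val -!colE !mxE.
rewrite -!mulmxA merge_mx_ket // !Hamiltonian_ket ?merge_configs //.
rewrite /H_ket mulmx_sumr; apply: eq_bigr => i _.
rewrite -scalemxAr mulmxBr !merge_mx_ket ?swap_configs // merge_swap.
(* When the two neighbours merge, the rates may differ, but both multiply a zero vector. *)
have [e|ne] := eqVneq (merge k i) (merge k (ordS i)).
  by rewrite swap_id // subrr !scaler0.
by rewrite Theta_merge.
Qed.

Lemma merge_mx_row_free : row_free merge_mx.
Proof.
have lift (a : 'I_#|configs s|) :
    {b : 'I_#|configs t| | merge (enum_val b) == enum_val a}.
  apply: sigW; have [k kP kE] := merge_onto (enum_valP a).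
  by exists (enum_rank_in kP k); rewrite enum_rankK_in ?kE.
(* A right inverse: it sends each basis vector to that of a chosen preimage. *)
apply/row_freeP; exists (\matrix_(b, a) (b == sval (lift a))%:R).
apply/matrixP => a a'; rewrite !mxE (bigD1 (sval (lift a'))) //= big1.
  rewrite !mxE eqxx mulr1 addr0; case: (lift a') => b /= /eqP->.
  by rewrite (inj_eq enum_val_inj).
by move=> b nb; rewrite !mxE (negbTE nb) mulr0.
Qed.

Lemma Spec_refine : (Spec p q s `<=` Spec p q t)%mset.
Proof.
apply/msubsetP => x; rewrite !SpecE.
have nz m (A : 'M[R[i]]_m) : char_poly A != 0 := monic_neq0 (char_poly_monic A).
have := dvdp_char_poly_quotient merge_mx_row_free merge_mx_Hamiltonian.
(* The power of ['X - x%:P] dividing the polynomial of [s] also divides that of [t]. *)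
by rewrite mup_geq //; apply: dvdp_trans; rewrite -mup_geq.
Qed.

End Merge.

Theorem theorem4p5 (R : realType) (L : nat) (p q : R)
    (hL : (2 <= L)%N) (hp : 0 <= p) (hq : 0 <= q) :
  (forall s t : {set 'I_L}, s \subset t -> t \subset Omega L ->
     (Spec p q s `<=` Spec p q t)%mset) /\
  (forall s : {set 'I_L}, s \subset Omega L ->
     (Spec p q s `<=` Spec p q (Omega L))%mset).
Proof. by split=> [s t st _|s sO]; apply: Spec_refine. Qed.
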